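(* Let $L:[0,\infty)\to(0,\infty]$ be finite for all $\delta>0$, convex, lower semicontinuous, nonincreasing, and such that $-1/L(\cdot)$ is convex. Then the self-smoothness constant $c_L$ satisfies $1\le c_L\le 2$.
   Context: Convention $1/\infty=0$. Define $\theta_L:\mathbb{R}\to\mathbb{R}$ by $\theta_L(s)=\inf_{\delta\ge 0}\{\frac{L(\delta)}{2}s^2+\delta\}$. For a function $M:[0,\infty)\to(0,\infty]$, a closed, convex, proper function $f:\mathbb{R}^d\to(-\infty,\infty]$ is called $M(\cdot)$-inexactly smooth if for all $x,y\in\mathbb{R}^d$, all $g_x\in\partial f(x)$ (convex subdifferential) and all $\delta\ge 0$, $$f(y)\le f(x)+\langle g_x,y-x\rangle+\frac{M(\delta)}{2}\|y-x\|^2+\delta$$ (nothing is imposed when $M(\delta)=\infty$). The self-smoothness constant is $$c_L=\inf\{c>0:\theta_L\text{ is }c\,L(\cdot/c)\text{-inexactly smooth}\};$$ equivalently, $c_L=\inf\{c>0:\ \theta_L(r)\le\theta_L(s)+g_s(r-s)+c\,\theta_L(r-s)\ \ \forall r,s\in\mathbb{R},\ g_s\in\partial\theta_L(s)\}$. *)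

(* Defs.v *)
From mathcomp Require Import all_boot all_order all_algebra.
From mathcomp Require Import all_classical all_reals all_analysis.

Set Implicit Arguments.
Unset Strict Implicit.
Unset Printing Implicit Defensive.

Import Order.TTheory GRing.Theory Num.Theory.
Import numFieldNormedType.Exports.

Local Open Scope classical_set_scope.
Local Open Scope ring_scope.
Local Open Scope ereal_scope.

(* Functions on [0, +oo[ are represented by functions on R of which only the
   restriction to [0, +oo[ is ever used. In \bar R, +oo * 0 = 0 and
   (+oo)^-1 = 0. *)

(* Meaningful for f that does not take both infinite values on D. *)
Definition convex_on (R : realType) (E : lmodType R) (D : set E)
    (f : E -> \bar R) : Prop :=
  forall x y (t : R), D x -> D y -> (0 <= t <= 1)%R ->
    f (t *: x + (1 - t) *: y)%R <= t%:E * f x + (1 - t)%:E * f y.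

Section Euclidean.
Variables (R : realType) (d : nat).
Implicit Types (x y g : 'rV[R]_d) (f : 'rV[R]_d -> \bar R).

(* The library norm on 'rV[R]_d is the sup norm, so the Euclidean structure is
   written through the dot product: |x|^2 = dot x x. *)
Definition dot x y : R := (\sum_(i < d) x ord0 i * y ord0 i)%R.

Definition proper f : Prop :=
  (forall x, -oo < f x) /\ (exists x, f x < +oo).

Definition closed_fun f : Prop :=
  closed [set p : 'rV[R]_d * R | f p.1 <= p.2%:E].

Definition subdifferential f x : set 'rV[R]_d :=
  [set g | forall y, f x + (dot g (y - x))%:E <= f y].

Definition inexactly_smooth (M : R -> \bar R) f : Prop :=
  [/\ closed_fun f, convex_on setT f, proper f &
    forall x y g (delta : R), subdifferential f x g -> (0 <= delta)%R ->
      M delta < +oo ->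
      f y <= f x + (dot g (y - x))%:E
             + M delta * (2^-1)%:E * (dot (y - x) (y - x))%:E + delta%:E].

End Euclidean.

Definition theta (R : realType) (L : R -> \bar R) (s : R) : \bar R :=
  ereal_inf [set L delta * (2^-1)%:E * (s ^+ 2)%:E + delta%:E
            | delta in [set delta : R | (0 <= delta)%R]].

(* R is identified with the space 'rV[R]_1 of row vectors of length 1. *)
Definition self_smoothness_constant (R : realType) (L : R -> \bar R) : \bar R :=
  ereal_inf [set c%:E | c in [set c : R | (0 < c)%R /\
    inexactly_smooth (fun delta => c%:E * L (delta / c)%R)
      (fun s : 'rV[R]_1 => theta L (s ord0 ord0))]].

(* Main.v *)
(* Put q = L / 2 and theta(s) = inf_{delta > 0} q(delta) s^2 + delta; by
   monotonicity of L the value delta = 0 can be left out, so everything is real.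
   As an infimum of affine functions of s^2, theta(s) = phi(s^2) with phi concave;
   concavity of 1/L makes theta convex. If g is a subgradient at s > 0, then
   p = g / (2s) is a supergradient of phi at s^2, and comparing p with q(delta)
   gives theta(s+u) <= theta(s) + g u + 2 (q(delta) u^2 + delta) for every delta,
   hence c_L <= 2. The bound c_L >= 1 is self-smoothness at s = 0 with g = 0. *)
Require Import Defs.
From mathcomp Require Import all_boot all_order all_algebra.
From mathcomp Require Import all_classical all_reals all_analysis.
From mathcomp Require Import ring lra.

Import Order.TTheory GRing.Theory Num.Theory.
Import numFieldNormedType.Exports.

Local Open Scope classical_set_scope.
Local Open Scope ring_scope.
Local Open Scope ereal_scope.

(** * Real envelopes of the parabolas [q delta * s ^+ 2 + delta] *)

Section RealEnvelope.
Set Implicit Arguments.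
Unset Strict Implicit.
Unset Printing Implicit Defensive.
Local Open Scope ring_scope.
Variables (R : realType) (q : R -> R).
Hypothesis q_gt0 : forall delta, 0 < delta -> 0 < q delta.

Definition envelope (s : R) : R :=
  inf [set q delta * s ^+ 2 + delta | delta in [set delta : R | 0 < delta]].

Let qpart_ge0 (s delta : R) : 0 < delta -> 0 <= q delta * s ^+ 2.
Proof. by move=> d0; rewrite mulr_ge0 ?sqr_ge0// ltW// q_gt0. Qed.

Lemma envelope_le (s delta : R) : 0 < delta ->
  envelope s <= q delta * s ^+ 2 + delta.
Proof.
move=> d0; apply: ge_inf; last by exists delta.
exists 0 => _ [d /= d_gt0 <-].
by rewrite addr_ge0 ?qpart_ge0// ltW.
Qed.

Lemma le_envelope (s y : R) :
  (forall delta, 0 < delta -> y <= q delta * s ^+ 2 + delta) ->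
  y <= envelope s.
Proof.
move=> H; apply: lb_le_inf; first by exists (q 1 * s ^+ 2 + 1), 1 => //=.
by move=> _ [d /= d0 <-]; exact: H.
Qed.

Lemma envelope_lt (s y : R) : envelope s < y ->
  exists2 delta, 0 < delta & q delta * s ^+ 2 + delta < y.
Proof.
move=> lty; apply: contrapT => H.
suff : y <= envelope s by rewrite leNgt lty.
apply: le_envelope => d d0; rewrite leNgt; apply/negP => lt_y.
by apply: H; exists d.
Qed.

Lemma envelope_ge0 (s : R) : 0 <= envelope s.
Proof.
by apply: le_envelope => d d0; rewrite addr_ge0 ?qpart_ge0// ltW.
Qed.

Lemma envelope0 : envelope 0 = 0.
Proof.
apply/eqP; rewrite eq_le envelope_ge0 andbT; apply/ler_addgt0Pl => e e0.
by have := envelope_le 0 e0; rewrite expr0n /= mulr0 add0r addr0.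
Qed.

Lemma envelopeN (s : R) : envelope (- s) = envelope s.
Proof. by rewrite /envelope sqrrN. Qed.

(** Checked parabola by parabola: for [r ^+ 2 <= s ^+ 2], scaling by [r ^+ 2] against [s ^+ 2] only
    shrinks the constant term; otherwise the quadratic term grows with [r ^+ 2]. The bound is
    continuous in [r], which later yields closedness of the epigraph. *)
Lemma envelope_shrink (r s : R) :
  Num.min (r ^+ 2) (s ^+ 2) * envelope s <= s ^+ 2 * envelope r.
Proof.
have [->|s0] := eqVneq s 0.
  rewrite expr0n /= mul0r (@min_idPr _ _ (r ^+ 2) 0 _) ?mul0r// sqr_ge0//.
have s2 : 0 < s ^+ 2 by rewrite exprn_even_gt0.
rewrite -ler_pdivrMl//; apply: le_envelope => d d0.
have e_le := envelope_le s d0.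
rewrite ler_pdivrMl//.
have [rs|/ltW sr] := leP (r ^+ 2) (s ^+ 2).
  apply: (le_trans (ler_wpM2l (sqr_ge0 r) e_le)).
  by have := ler_wpM2r (ltW d0) rs; lra.
apply: (ler_wpM2l (ltW s2)); apply: (le_trans e_le).
by rewrite lerD2r ler_wpM2l// ltW// q_gt0.
Qed.

(** The hypothesis is concavity of [1 / q]. Joint convexity of [a ^+ 2 / w], taken at [w = 1 / q],
    makes the convex combination of near-optimal parameters for [a] and [b] a good parameter for the
    combined point. *)
Lemma envelope_convex :
    (forall x y t, 0 < x -> 0 < y -> 0 <= t <= 1 ->
      t / q x + (1 - t) / q y <= (q (t * x + (1 - t) * y))^-1) ->
  forall a b t, 0 <= t <= 1 ->
    envelope (t * a + (1 - t) * b) <= t * envelope a + (1 - t) * envelope b.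
Proof.
move=> qi a b t t01; apply/ler_addgt0Pl => e e0.
have [x x0 xlt] : exists2 x, 0 < x & q x * a ^+ 2 + x < envelope a + e.
  by apply: envelope_lt; rewrite ltrDl.
have [y y0 ylt] : exists2 x, 0 < x & q x * b ^+ 2 + x < envelope b + e.
  by apply: envelope_lt; rewrite ltrDl.
have [t0 t1] := andP t01.
have t1' : 0 <= 1 - t by rewrite subr_ge0.
have z0 : 0 < t * x + (1 - t) * y.
  have [->|tn0] := eqVneq t 0; first by rewrite mul0r add0r subr0 mul1r.
  apply: ltr_pwDl; first by rewrite mulr_gt0// lt_def tn0.
  by rewrite mulr_ge0// ltW.
have := ler_wpM2l t0 (ltW xlt); have := ler_wpM2l t1' (ltW ylt).
have := envelope_le (t * a + (1 - t) * b) z0.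
have := qi _ _ _ x0 y0 t01.
set z := t * x + (1 - t) * y in z0 *.
move: (q_gt0 x0) (q_gt0 y0) (q_gt0 z0) => qx qy qz qi' ez yle xle.
suff : q z * (t * a + (1 - t) * b) ^+ 2 <=
       t * (q x * a ^+ 2) + (1 - t) * (q y * b ^+ 2) by rewrite /z in z0 ez *; lra.
(* Cauchy-Schwarz with weights t / q x and (1 - t) / q y *)
have -> : q z = ((q z)^-1)^-1 by rewrite invrK.
have h0 : 0 < (q z)^-1 by rewrite invr_gt0.
rewrite mulrC ler_pdivrMr//.
have S0 : 0 <= t * (q x * a ^+ 2) + (1 - t) * (q y * b ^+ 2).
  by apply: addr_ge0; apply: mulr_ge0 => //; exact: qpart_ge0.
apply: le_trans (ler_wpM2l S0 qi').
rewrite -subr_ge0.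
have -> : (t * (q x * a ^+ 2) + (1 - t) * (q y * b ^+ 2)) *
   (t / q x + (1 - t) / q y) - (t * a + (1 - t) * b) ^+ 2 =
   (t * (1 - t)) * (q x * a - q y * b) ^+ 2 / (q x * q y).
  by field; rewrite !gt_eqF.
apply: divr_ge0; first by rewrite mulr_ge0 ?sqr_ge0// mulr_ge0.
by rewrite mulr_ge0// ltW.
Qed.

(* The envelope is concave as a function of [s ^+ 2], so at [s != 0] a
   subgradient [g] forces the slope [g / (2 * s)] in that variable. *)
Lemma envelope_le_tangent (s p r : R) : 0 < s ->
  (forall x, envelope s + 2 * p * s * (x - s) <= envelope x) ->
  envelope r <= envelope s + p * (r ^+ 2 - s ^+ 2).
Proof.
move=> s0 sub; rewrite leNgt; apply/negP => ltr.
pose eta := envelope r - (envelope s + p * (r ^+ 2 - s ^+ 2)).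
pose k := r ^+ 2 - s ^+ 2; pose B := envelope s + 1.
have eta0 : 0 < eta by rewrite /eta subr_gt0.
have B0 : 0 < B by rewrite /B ltr_wpDl ?envelope_ge0.
have s4 : 0 < s ^+ 4 by rewrite exprn_gt0.
pose C := 4 * (B * k ^+ 2 + 1).
have C0 : 0 < C by rewrite /C; have := sqr_ge0 k; nra.
(* The optimality defect [D] stays below three caps: 1 bounds [q d * s ^+ 2] by [B], [eta / 2] keeps
   half of the violation [eta], and the last contradicts [h1]. The [+ 1] in [C] covers [k = 0]. *)
pose e := Num.min 1 (Num.min (eta / 2) (eta ^+ 2 * s ^+ 4 / C)).
have e0 : 0 < e.
  rewrite /e !lt_min ltr01 /=; apply/andP; split; apply: divr_gt0 => //.
  by rewrite mulr_gt0// exprn_gt0.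
have [d d0 dlt] : exists2 x, 0 < x & q x * s ^+ 2 + x < envelope s + e.
  by apply: envelope_lt; rewrite ltrDl.
have q0 := q_gt0 d0.
pose D := q d * s ^+ 2 + d - envelope s.
have D0 : 0 <= D by rewrite /D subr_ge0 envelope_le.
have De : D < e by rewrite /D; lra.
have /and3P[D1 D2 D3] : [&& D < 1, D < eta / 2 & D < eta ^+ 2 * s ^+ 4 / C].
  by move: De; rewrite /e !lt_min.
(* The parabola of [d] lies above the tangent line at [s]; their difference is smallest at
   [p * s / q d], so this is the discriminant condition. A nearly optimal [d] thus has [q d] close
   to [p]. *)
have disc : (s * (q d - p)) ^+ 2 <= D * q d.
  have := le_trans (sub (p * s / q d)) (envelope_le _ d0).
  move=> /(ler_wpM2r (ltW q0)).
  rewrite -subr_ge0 => disc; rewrite -subr_ge0; apply: (le_trans disc).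
  by rewrite le_eqVlt; apply/orP; left; apply/eqP; rewrite /D; field; rewrite gt_eqF.
have gap : eta - D <= (q d - p) * k.
  by have := envelope_le r d0; rewrite /eta /D /k; lra.
have qB : q d * s ^+ 2 <= B by rewrite /B; move: D1; rewrite /D; lra.
have sq : (eta / 2) ^+ 2 <= ((q d - p) * k) ^+ 2.
  by rewrite ler_pXn2r// ?nnegrE; lra.
have h1 : s ^+ 4 * (eta / 2) ^+ 2 <= D * B * k ^+ 2.
  apply: (le_trans (ler_wpM2l (ltW s4) sq)).
  have -> : s ^+ 4 * ((q d - p) * k) ^+ 2 =
     s ^+ 2 * k ^+ 2 * (s * (q d - p)) ^+ 2 by ring.
  have sk : 0 <= s ^+ 2 * k ^+ 2 by rewrite mulr_ge0 ?sqr_ge0.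
  apply: (le_trans (ler_wpM2l sk disc)).
  have -> : s ^+ 2 * k ^+ 2 * (D * q d) = (D * k ^+ 2) * (q d * s ^+ 2) by ring.
  have Dk : 0 <= D * k ^+ 2 by rewrite mulr_ge0 ?sqr_ge0.
  by apply: (le_trans (ler_wpM2l Dk qB)); lra.
move: D3; rewrite ltr_pdivlMr// /C; nra.
Qed.

(* [p] is the slope of the envelope at [s] in the variable [s ^+ 2], [k] the
   curvature of a competing quadratic and [u] the increment. If [p <= k], or if
   [- s <= u <= 0], the tangent bound at [s] is enough; otherwise bound the
   envelope at [s + u] by the competitor. Only for [u < - s] does this cost the
   factor 2, the excess being absorbed by the subgradient inequality at [- u]. *)
Let envelope_self_smooth_pos (s g r : R) : 0 < s ->
  (forall x, envelope s + g * (x - s) <= envelope x) ->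
  envelope r <= envelope s + g * (r - s) + 2 * envelope (r - s).
Proof.
move=> s0 sub0; pose p := g / (2 * s).
have gE : g = 2 * p * s by rewrite /p; field; rewrite gt_eqF.
have sub x : envelope s + 2 * p * s * (x - s) <= envelope x.
  by rewrite -gE.
rewrite {}gE {sub0}.
have tan x := @envelope_le_tangent s p x s0 sub.
have s2 : 0 < s ^+ 2 by rewrite exprn_gt0.
(* The tangent bound at 0. Against a competitor [k] it gives [(p - k) * s ^+ 2 <= d], which pays for
   a slope [p] above [k]. *)
have ps : p * s ^+ 2 <= envelope s.
  by have := tan 0; have := envelope_ge0 0; rewrite expr0n /=; lra.
pose u := r - s.
have -> : r = s + u by rewrite /u; lra.
have -> : s + u - s = u by lra.
suff : (envelope (s + u) - envelope s - 2 * p * s * u) / 2 <= envelope u by lra.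
apply: le_envelope => d d0; have q0 := q_gt0 d0; rewrite ler_pdivrMr//.
have u2 : 0 <= u ^+ 2 by exact: sqr_ge0.
have es := envelope_le s d0; have eu := envelope_le u d0.
have esu := envelope_le (s + u) d0.
have tsu := tan (s + u).
have := qpart_ge0 u d0.
move: (q d) q0 es eu esu => k k0 es eu esu ku0.
have [pk|kp] := leP p k; first by nra.
have [u_ge0|u_lt0] := leP 0 u.
  have : 0 <= (p - k) * (s * u) by rewrite !mulr_ge0//; lra.
  have : 0 <= (p - k) * s ^+ 2 by rewrite mulr_ge0//; lra.
  nra.
have [us|su] := leP (u ^+ 2) (s ^+ 2).
  have : 0 <= (p - k) * (s ^+ 2 - u ^+ 2) by rewrite mulr_ge0//; lra.
  nra.
have su' : 0 < - u - s by nra.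
have := sub (- u); rewrite envelopeN => subu.
have : 0 <= k * (s * (- u - s)) by rewrite !mulr_ge0//; lra.
nra.
Qed.

Lemma envelope_self_smooth (s g r : R) :
  (forall x, envelope s + g * (x - s) <= envelope x) ->
  envelope r <= envelope s + g * (r - s) + 2 * envelope (r - s).
Proof.
move=> sub; have [s0|s0|s0] := ltgtP s 0; last first.
(* At [s = 0], the subgradient inequality at [- r] and evenness give [- g * r <= envelope r]. *)
- move: sub; rewrite s0 subr0 => /(_ (- r)); rewrite envelopeN.
  rewrite envelope0; lra.
- exact: envelope_self_smooth_pos.
- have := @envelope_self_smooth_pos (- s) (- g) (- r).
  rewrite oppr_gt0 !envelopeN => /(_ s0).
  rewrite (_ : - r - - s = - (r - s)) ?envelopeN; last by lra.
  rewrite mulrNN; apply => x.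
  by have := sub (- x); rewrite envelopeN; lra.
Qed.

End RealEnvelope.

(** * The extended-real function [theta] and its self-smoothness *)

Section Theta.
Set Implicit Arguments.
Unset Strict Implicit.
Unset Printing Implicit Defensive.
Variables (R : realType) (L : R -> \bar R).
Hypothesis L_gt0 : forall delta : R, (0 <= delta)%R -> 0 < L delta.
Hypothesis L_fin : forall delta : R, (0 < delta)%R -> L delta < +oo.
Hypothesis L_nincr : forall x y : R, (0 <= x)%R -> (x <= y)%R -> L y <= L x.
Hypothesis invL_convex :
  convex_on (`[0%R, +oo[ : set R^o) (fun delta => - (L delta)^-1).

(** [fine] sends +oo to 0, so [q 0] may be a junk value; [envelope] samples positive parameters
    only. *)
Let q (delta : R) : R := (fine (L delta) / 2)%R.

Let LE (delta : R) : (0 < delta)%R -> L delta = (2 * q delta)%:E.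
Proof.
move=> d0; rewrite /q mulrCA divff// mulr1 fineK// ge0_fin_numE ?L_fin//.
by rewrite ltW// L_gt0// ltW.
Qed.

Let q_gt0 (delta : R) : (0 < delta)%R -> (0 < q delta)%R.
Proof.
move=> d0; have := L_gt0 (ltW d0); rewrite LE// lte_fin; lra.
Qed.

(** A parameter [d], possibly 0, can be moved to [d + e], where [L] is finite and no larger, at the
    cost of [e]. The case [s = 0] is separate because +oo * 0 = 0. *)
Lemma theta_envelope (s : R) : theta L s = (envelope q s)%:E.
Proof.
apply/eqP; rewrite eq_le; apply/andP; split.
  apply/lee_addgt0Pr => e e0.
  have /envelope_lt[d d0 dlt] : (envelope q s < envelope q s + e)%R.
    by rewrite ltrDl.
  apply: (@le_trans _ _ (q d * s ^+ 2 + d)%:E); last by rewrite lee_fin ltW.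
  apply: ereal_inf_lbound; exists d; first exact: ltW.
  rewrite LE// -!EFinM -EFinD; congr EFin; lra.
apply: le_ereal_inf_tmp => _ [d /= d0 <-].
have [s0|s0] := eqVneq s 0%R.
  by rewrite s0 expr0n /= mule0 add0e lee_fin envelope0.
have : L d * (2^-1)%:E * (s ^+ 2)%:E + d%:E = L d * (2^-1 * s ^+ 2)%:E + d%:E.
  by rewrite -muleA.
move=> ->.
have c0 : (0 < 2^-1 * s ^+ 2)%R by rewrite mulr_gt0// exprn_even_gt0.
have := L_gt0 d0; case LdE : (L d) => [l| |] //= l0; last first.
  by rewrite gt0_mulye ?lte_fin// addye// leey.
rewrite -EFinM -EFinD lee_fin; apply/ler_addgt0Pl => e e0.
have de0 : (0 < d + e)%R by lra.
have := L_nincr d0 (y := d + e); rewrite LE// LdE lee_fin => ql.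
have {}ql : (2 * q (d + e) <= l)%R by apply: ql; lra.
apply: (le_trans (envelope_le q_gt0 s de0)).
have := ler_wpM2r (ltW c0) ql.
lra.
Qed.

Let envelope_q_convex (a b t : R) : (0 <= t <= 1)%R ->
  (envelope q (t * a + (1 - t) * b) <=
   t * envelope q a + (1 - t) * envelope q b)%R.
Proof.
apply: envelope_convex => // x y {}t x0 y0 t01.
have z0 : (0 < t * x + (1 - t) * y)%R.
  have [t0 t1] := andP t01.
  have [->|tn0] := eqVneq t 0%R; first by rewrite mul0r add0r subr0 mul1r.
  apply: ltr_pwDl; first by rewrite mulr_gt0// lt_def tn0.
  by rewrite mulr_ge0 ?subr_ge0// ltW.
have D (u : R) : (0 < u)%R -> [set` `[0%R, +oo[] u.
  by move=> u0; rewrite /= in_itv /= andbT ltW.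
have := invL_convex (D _ x0) (D _ y0) t01.
have -> : (t *: (x : R^o) + (1 - t) *: (y : R^o) = t * x + (1 - t) * y)%R by [].
have inv u : (0 < u)%R -> (L u)^-1 = (2^-1 / q u)%:E.
  by move=> u0; rewrite LE// inver gt_eqF ?invfM// mulr_gt0 ?q_gt0.
rewrite !inv// -!EFinN -!EFinM -EFinD lee_fin; lra.
Qed.

(** By [envelope_shrink], the epigraph is an intersection over [s] of sets cut out by continuous
    inequalities. *)
Lemma theta_closed :
  closed_fun (fun s : 'rV[R]_1 => theta L (s ord0 ord0)).
Proof.
rewrite /closed_fun.
have -> : [set p : 'rV[R]_1 * R | theta L (p.1 ord0 ord0) <= p.2%:E] =
    \bigcap_(s in [set: R]) [set p : 'rV[R]_1 * R |
      Num.min ((p.1 ord0 ord0) ^+ 2) (s ^+ 2) * envelope q s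
        - s ^+ 2 * p.2 <= 0]%R.
  apply/seteqP; split => [[x y] /= xy s _ /=|[x y] /= H].
    move: xy; rewrite theta_envelope lee_fin => xy.
    rewrite subr_le0; apply: (le_trans (envelope_shrink q_gt0 _ _)).
    by rewrite ler_wpM2l ?sqr_ge0.
  rewrite theta_envelope lee_fin.
  (* The constraint with [s] equal to the point itself is exact, but it is vacuous at 0, where
     [s = 1] is used instead. *)
  have [x0|x0] := eqVneq (x ord0 ord0) 0%R.
    have := H 1%R I; rewrite /= x0 expr0n /= expr1n min_l// mul0r mul1r.
    by rewrite envelope0//; lra.
  have := H (x ord0 ord0) I.
  by rewrite /= minxx subr_le0 ler_pM2l// exprn_even_gt0.
apply: closed_bigI => s _.
pose F (p : 'rV[R]_1 * R) : R := (Num.min ((p.1 ord0 ord0) ^+ 2) (s ^+ 2) *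
  envelope q s - s ^+ 2 * p.2)%R.
apply: (@preimage_closed _ _ F [set z : R | (z <= 0)%R]); last exact: closed_le.
move=> p _; rewrite /F.
have cc : {for p, continuous (fun p : 'rV[R]_1 * R => p.1 ord0 ord0)}.
  apply: (@continuous_comp _ _ _ fst (fun M : 'rV[R]_1 => M ord0 ord0)).
    exact: cvg_fst.
  exact: coord_continuous.
apply: cvgB; apply: cvgM; [|exact: cvg_cst|exact: cvg_cst|exact: cvg_snd].
apply: (@continuous_min R _ (fun p : 'rV[R]_1 * R => (p.1 ord0 ord0) ^+ 2)%R
  (cst (s ^+ 2)%R)); last exact: cvg_cst.
exact: (cvgM cc cc).
Qed.

Lemma theta_convex :
  convex_on setT (fun s : 'rV[R]_1 => theta L (s ord0 ord0)).
Proof.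
move=> x y t _ _ t01; rewrite !theta_envelope -!EFinM -EFinD lee_fin !mxE.
exact: envelope_q_convex.
Qed.

Lemma theta_proper :
  Defs.proper (fun s : 'rV[R]_1 => theta L (s ord0 ord0)).
Proof.
by split=> [x|]; [|exists 0%R]; rewrite theta_envelope ?ltNyr ?ltry.
Qed.

Let dot1 (x y : 'rV[R]_1) : dot x y = (x ord0 ord0 * y ord0 ord0)%R.
Proof. by rewrite /dot big_ord1. Qed.

Lemma theta_inexactly_smooth2 :
  inexactly_smooth (fun delta => 2%:E * L (delta / 2)%R)
    (fun s : 'rV[R]_1 => theta L (s ord0 ord0)).
Proof.
split; [exact: theta_closed|exact: theta_convex|exact: theta_proper|].
move=> x y g delta sub delta0 _; rewrite !dot1 !mxE.
set s := x ord0 ord0; set r := y ord0 ord0; set g0 := g ord0 ord0.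
have subR z : (envelope q s + g0 * (z - s) <= envelope q z)%R.
  have := sub (const_mx z).
  by rewrite dot1 !theta_envelope !mxE -EFinD lee_fin.
have key := envelope_self_smooth q_gt0 r subR.
(* Doubling the competitor of parameter [delta / 2] produces exactly the modulus [2 * L (delta / 2)]
   and the error [delta]. *)
have : theta L (r - s) <=
    L (delta / 2)%R * (2^-1)%:E * ((r - s) ^+ 2)%:E + (delta / 2)%:E.
  by apply: ereal_inf_lbound; exists (delta / 2)%R => //=; rewrite divr_ge0.
rewrite !theta_envelope -/s -/r.
have := L_gt0 (delta := delta / 2).
rewrite divr_ge0// => /(_ isT); case: (L _) => [l| |] //= l0.
  rewrite -!EFinM -!EFinD !lee_fin; nra.
move=> _.
(* For infinite [L (delta / 2)] the right-hand side is +oo, except at [r = s], where the quadratic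
   term is 0. *)
have [rs|rs] := eqVneq r s.
  by rewrite rs subrr !mulr0 !mule0 !adde0 -EFinD lee_fin; lra.
rewrite gt0_muley ?lte_fin// gt0_mulye ?lte_fin// -expr2 gt0_mulye; last first.
  by rewrite lte_fin exprn_even_gt0// subr_eq0.
by rewrite addey// addye// leey.
Qed.

(** Parameters [d >= 1] contribute at least 1, the others at least [q 1] by monotonicity. This
    allows cancelling [envelope q 1] in the lower bound on [c]. *)
Let theta1_gt0 : 0 < theta L 1%R.
Proof.
have L1 := q_gt0 (ltr01 : (0 < 1 :> R)%R).
rewrite theta_envelope lte_fin.
apply: (@lt_le_trans _ _ (Num.min 1 (q 1))%R); first by rewrite lt_min ltr01.
apply: le_envelope => d d0; have qd := q_gt0 d0.
rewrite expr1n mulr1 ge_min.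
have [d1|/ltW d1] := leP 1%R d; first by apply/orP; left; lra.
have := L_nincr (ltW d0) d1; rewrite !LE// lee_fin => qq.
by apply/orP; right; lra.
Qed.

(* At [s = 0] the subgradient [0] turns the self-smoothness inequality into
   [theta r <= c * theta r]. *)
Lemma theta_inexactly_smooth_ge1 (c : R) : (0 < c)%R ->
  inexactly_smooth (fun delta => c%:E * L (delta / c)%R)
    (fun s : 'rV[R]_1 => theta L (s ord0 ord0)) -> (1 <= c)%R.
Proof.
move=> c0 [_ _ _ smooth].
have sub : subdifferential (fun s : 'rV[R]_1 => theta L (s ord0 ord0))
    0%R 0%R.
  move=> y; rewrite dot1 !theta_envelope !mxE mul0r adde0 envelope0// lee_fin.
  exact: envelope_ge0.
have := theta1_gt0; rewrite theta_envelope lte_fin => e1.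
suff : (envelope q 1 / c <= envelope q 1)%R.
  by rewrite ler_pdivrMr// -{1}[envelope q 1]mulr1 ler_pM2l.
apply: le_envelope => // d d0.
rewrite ler_pdivrMr//.
(* The error [d * c] makes the rescaled argument of [L] equal to [d], so the bound is [c] times the
   competitor of parameter [d]. *)
have := smooth 0%R (const_mx 1%R) 0%R (d * c)%R sub.
have dc0 : (0 <= d * c)%R by rewrite ltW// mulr_gt0.
rewrite mulfK ?gt_eqF// LE// -EFinM ltry => /(_ dc0 isT).
rewrite !dot1 !theta_envelope !mxE envelope0// -!EFinM -!EFinD lee_fin; lra.
Qed.

End Theta.

Theorem theorem3p2 (R : realType) (L : R -> \bar R)
  (L_gt0 : forall delta : R, (0 <= delta)%R -> 0 < L delta)
  (L_fin : forall delta : R, (0 < delta)%R -> L delta < +oo)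
  (L_convex : convex_on (`[0%R, +oo[ : set R^o) L)
  (L_lsc : lower_semicontinuous (L : subspace `[0%R, +oo[ -> \bar R))
  (L_nincr : forall x y : R, (0 <= x)%R -> (x <= y)%R -> L y <= L x)
  (invL_convex : convex_on (`[0%R, +oo[ : set R^o) (fun delta => - (L delta)^-1)) :
  1 <= self_smoothness_constant L <= 2%:E.
Proof.
apply/andP; split.
  apply: le_ereal_inf_tmp => _ [c /= [c0 smooth] <-].
  by rewrite lee_fin; exact: (theta_inexactly_smooth_ge1 L_gt0 L_fin L_nincr).
apply: ereal_inf_lbound; exists 2%R => //=; split => //.
exact: (theta_inexactly_smooth2 L_gt0 L_fin L_nincr invL_convex).
Qed.
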